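(* Let $R\ge1$ and let $\vec x=(x_1,\dots,x_R)$, $\vec y=(y_1,\dots,y_R)$ be complex numbers. For all complex $\xi,\xi'\notin\{x_1,\dots,x_R\}$ and $\eta,\eta'\notin\{y_1,\dots,y_R\}$, the matrices $\mathcal M^{(R)}(\vec x,\vec y,\xi,\eta)$ and $\mathcal M^{(R)}(\vec x,\vec y,\xi',\eta')$ commute: $$\mathcal M^{(R)}(\vec x,\vec y,\xi,\eta)\,\mathcal M^{(R)}(\vec x,\vec y,\xi',\eta')=\mathcal M^{(R)}(\vec x,\vec y,\xi',\eta')\,\mathcal M^{(R)}(\vec x,\vec y,\xi,\eta).$$
   Context: $\Sigma_R$ is the group of permutations of $\{1,\dots,R\}$. $\mathcal M^{(R)}(\vec x,\vec y,\xi,\eta)$ is the $R!\times R!$ matrix with rows and columns indexed by $\Sigma_R$ and entries $$\mathcal M^{(R)}_{\pi,\rho}(\vec x,\vec y,\xi,\eta)=\prod_{i=1}^R\Big(\delta_{\pi(i),\rho(i)}+\frac1{(x_i-\xi)(y_{\pi(i)}-\eta)}\Big),\qquad \pi,\rho\in\Sigma_R .$$ *)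

(* Defs.v *)
From HB Require Import structures.
From mathcomp Require Import all_boot all_order all_algebra all_fingroup.
From mathcomp Require Import complex.
From mathcomp Require Import reals.

Set Implicit Arguments.
Unset Strict Implicit.
Unset Printing Implicit Defensive.

Import GRing.Theory.
Local Open Scope ring_scope.

Definition M_entry (F : fieldType) (n : nat) (x y : 'I_n -> F) (xi eta : F)
    (p r : 'S_n) : F :=
  \prod_(i < n) ((p i == r i)%:R + 1 / ((x i - xi) * (y (p i) - eta))).

(* Matrices are indexed by ordinals, so the rows and columns are labelled by
   permutations through the enumeration of 'S_n, which has n! elements. *)
Definition M_mx (F : fieldType) (n : nat) (x y : 'I_n -> F) (xi eta : F) :
    'M[F]_#|{: 'S_n}| :=
  \matrix_(a, b) M_entry x y xi eta (enum_val a) (enum_val b).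

(* Main.v *)
Require Import Defs.
From HB Require Import structures.
From mathcomp Require Import all_boot all_order all_algebra all_fingroup.
From mathcomp Require Import complex.
From mathcomp Require Import reals.
From mathcomp Require Import ring.

Set Implicit Arguments.
Unset Strict Implicit.
Unset Printing Implicit Defensive.

Import GRing.Theory.
Local Open Scope ring_scope.

(** With a_i = 1/(x_i - xi), b_j = 1/(y_j - eta), relabelling the rows reduces an
    entry of the product to a sum over r in S_n of
      prod_i (delta(r i, i) + a_i b_i) (delta(r i, s i) + a'_i b'_(s i)),
    and the claim says that exchanging primed and unprimed data does not change
    it.  Expanding the product, every i picks one of four colours (which of the
    two deltas are dropped); the number of r compatible with a colouring is k!,
    k being the number of points where both are dropped, unless a local condition
    on the colours of i and s i fails.  Hence the sum is the image under
    X^k |-> k! of a polynomial that is a product of traces of transfer matrices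
    along the cycles of s.  These matrices factor through two states, and since
    1/a_i - 1/a'_i and 1/b_j - 1/b'_j do not depend on i and j, an explicit 2x2
    gauge matrix G_i conjugates L_i into its swapped version L'_i:
    L_i G_(s i) = G_i L'_i. *)

(** * Loop sums: cyclicity and gauge invariance *)

(** The product over the cycles of [s] of the traces of the products of the
    matrices [L i] along the cycle, written without cycles. *)
Definition loop_sum (R : comNzRingType) (I S : finType) (s : {perm I})
    (L : I -> S -> S -> R) : R :=
  \sum_(f : {ffun I -> S}) \prod_i L i (f i) (f (s i)).

Lemma loop_sum_ext (R : comNzRingType) (I S : finType) (s : {perm I})
    (L L' : I -> S -> S -> R) :
  (forall i x y, L i x y = L' i x y) -> loop_sum s L = loop_sum s L'.
Proof. by move=> e; apply: eq_bigr => f _; apply: eq_bigr => i _. Qed.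

(** This is tr(UV) = tr(VU) along each cycle: keep the intermediate states [t] and sum out the
    original ones, shifted by [s]. *)
Lemma loop_sum_cyclic (R : comNzRingType) (I S T : finType) (s : {perm I})
    (U : I -> S -> T -> R) (V : I -> T -> S -> R) :
  loop_sum s (fun i x y => \sum_t U i x t * V i t y) =
  loop_sum s (fun i t t' => \sum_x V i t x * U (s i) x t').
Proof.
rewrite /loop_sum.
under eq_bigr => f _ do rewrite bigA_distr_bigA /=.
rewrite exchange_big /=; apply: eq_bigr => g _.
rewrite bigA_distr_bigA /=.
have shift_bij : bijective (fun f : {ffun I -> S} => [ffun i => f (s i)]).
  exists (fun f : {ffun I -> S} => [ffun i => f ((s^-1)%g i)]) => f;
    by apply/ffunP => i; rewrite !ffunE ?permK ?permKV.
rewrite [RHS](reindex _ (onW_bij _ shift_bij)) /=; apply: eq_bigr => f _.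
rewrite !big_split /= mulrC; congr (_ * _).
  by apply: eq_bigr => i _; rewrite ffunE.
by rewrite (reindex_inj (@perm_inj _ s)); apply: eq_bigr => i _; rewrite ffunE.
Qed.

Lemma loop_sum_scale (R : comNzRingType) (I S : finType) (s : {perm I})
    (d : I -> R) (L : I -> S -> S -> R) :
  loop_sum s (fun i x y => d i * L i x y) = (\prod_i d i) * loop_sum s L.
Proof.
by rewrite /loop_sum mulr_sumr; apply: eq_bigr => f _; rewrite big_split.
Qed.

(** Inserting [G H = d] at [s i] after each [L i] gives [G i * L' i * H (s i)], and cyclicity brings
    [H (s i)] next to [G (s i)]. Allowing a scalar [d] instead of 1 avoids inverting [G] over
    polynomials. *)
Lemma loop_sum_gauge (R : idomainType) (I S : finType) (s : {perm I})
    (G H : I -> S -> S -> R) (d : I -> R) (L L' : I -> S -> S -> R) :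
  (forall i, d i != 0) ->
  (forall i x y, \sum_z G i x z * H i z y = d i * (x == y)%:R) ->
  (forall i x y, \sum_z H i x z * G i z y = d i * (x == y)%:R) ->
  (forall i x y, \sum_z L i x z * G (s i) z y = \sum_z G i x z * L' i z y) ->
  loop_sum s L = loop_sum s L'.
Proof.
move=> d0 GH HG LG.
have D0 : \prod_i d (s i) != 0 by apply/prodf_neq0.
apply: (mulfI D0); rewrite -!loop_sum_scale.
transitivity (loop_sum s (fun i x y =>
    \sum_z G i x z * (\sum_w L' i z w * H (s i) w y))).
  apply: loop_sum_ext => i x y.
  transitivity (\sum_w (\sum_z L i x z * G (s i) z w) * H (s i) w y).
    under [RHS]eq_bigr => w _ do rewrite mulr_suml.
    rewrite exchange_big /=.
    under [RHS]eq_bigr => z _.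
      under eq_bigr => w _ do rewrite -mulrA.
      rewrite -mulr_sumr GH; over.
    rewrite (bigD1 y) //= eqxx big1 ?addr0 ?mulr1 1?mulrC // => z /negPf ->.
    by rewrite !mulr0.
  under eq_bigr => w _ do rewrite LG mulr_suml.
  rewrite exchange_big /=; apply: eq_bigr => z _; rewrite mulr_sumr.
  by apply: eq_bigr => w _; rewrite mulrA.
rewrite (@loop_sum_cyclic _ _ _ _ _ G
  (fun i z y => \sum_w L' i z w * H (s i) w y)).
apply: loop_sum_ext => i x y.
under eq_bigr => z _ do rewrite mulr_suml.
rewrite exchange_big /=.
under eq_bigr => w _.
  under eq_bigr => z _ do rewrite -mulrA.
  rewrite -mulr_sumr HG; over.
rewrite (bigD1 y) //= eqxx big1 ?addr0 ?mulr1 1?mulrC // => z /negPf ->.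
by rewrite !mulr0.
Qed.

(** * The linear form X^k -> k! *)

Definition fact_form (R : comNzRingType) (n : nat) (p : {poly R}) : R :=
  \sum_(k < n.+1) p`_k * (k`!)%:R.

Lemma fact_form_sum (R : comNzRingType) (n : nat) (J : finType)
    (p : J -> {poly R}) :
  fact_form n (\sum_j p j) = \sum_j fact_form n (p j).
Proof.
rewrite /fact_form exchange_big /=; apply: eq_bigr => k _.
by rewrite coef_sum mulr_suml.
Qed.

Lemma fact_form_monomial (R : comNzRingType) (n k : nat) (c : R) :
  (k <= n)%N -> fact_form n (c%:P * 'X^k) = c * (k`!)%:R.
Proof.
move=> kn; have kn1 : (k < n.+1)%N by [].
rewrite /fact_form (bigD1 (Ordinal kn1)) //= coefCM coefXn eqxx mulr1.
rewrite big1 ?addr0 // => j jk.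
rewrite coefCM coefXn; suff /negPf -> : (j : nat) != k by rewrite mulr0 mul0r.
by apply: contra jk => /eqP e; apply/eqP/val_inj.
Qed.

(** * Counting the permutations that fit a colouring *)

Lemma perm_extend (T : finType) (A : seq T) (f : T -> T) :
  {in A &, injective f} -> exists p : {perm T}, {in A, p =1 f}.
Proof.
elim: A => [|x A IH] finj; first by exists 1%g.
have [|p pA] := IH; first by move=> y z yA zA; apply: finj; rewrite inE ?yA ?zA orbT.
have [xA|xA] := boolP (x \in A).
  by exists p => y; rewrite inE => /orP[/eqP->|]; apply: pA.
(* The transposition corrects the value at [x]; injectivity of [p] and [f] keeps it away from the
   values on [A]. *)
exists (p * tperm (p x) (f x))%g => y; rewrite inE permM => /orP[/eqP->|yA].
  by rewrite tpermL.
have yx : y != x by apply: contraNneq xA => <-.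
have pxy : p x != p y by rewrite (inj_eq perm_inj) eq_sym.
rewrite tpermD //; first exact: pA.
rewrite pA //; apply: contraNneq yx => fxy.
by apply/eqP/finj; rewrite ?inE ?eqxx ?yA ?orbT.
Qed.

Lemma card_perm_agree (T : finType) (p0 : {perm T}) (A : {set T}) :
  #|[set p : {perm T} | [forall i, (i \in A) || (p i == p0 i)]]| = #|A|`!.
Proof.
rewrite -card_perm -[RHS](card_imset _ (@mulIg _ p0)); apply: eq_card.
move=> p; rewrite inE; apply/forallP/imsetP => [pA|[q qA ->] i].
  exists (p * p0^-1)%g; last by rewrite mulgKV.
  apply/subsetP => i; rewrite !inE permM => ne.
  have := pA i; case: (i \in A) => //= /eqP e.
  by rewrite e permK eqxx in ne.
rewrite permM (inj_eq perm_inj); case: (boolP (i \in A)) => //= iA.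
by apply/eqP; apply: (out_perm qA).
Qed.

Definition two_row_sum (R : comNzRingType) (I : finType) (s : {perm I})
    (al be : I -> R) : R :=
  \sum_(r : {perm I})
    \prod_i (((r i == i)%:R + al i) * ((r i == s i)%:R + be i)).

Definition fits (I : finType) (s : {perm I}) (c : I -> bool * bool)
    (r : {perm I}) : bool :=
  [forall i, ((c i).1 || (r i == i)) && ((c i).2 || (r i == s i))].

(** Colour [(false, false)] forces [r i = i = s i]; [(true, false)] at [i] and [(false, true)] at
    [s i] would send both points to [s i]. *)
Definition admissible (I : eqType) (s : I -> I) (i : I) (c d : bool * bool) :
    bool :=
  ((c != (false, false)) || (s i == i)) &&
  ~~ ((c == (true, false)) && (d == (false, true))).

(** Off [D] an admissible colouring prescribes [r] injectively, so some [p0] realises these values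
    and [r] is free only to permute within [D]. *)
Lemma card_fits (I : finType) (s : {perm I}) (c : I -> bool * bool) :
  #|[set r | fits s c r]| =
  ([forall i, admissible s i (c i) (c (s i))] *
   #|[set i | (c i).1 && (c i).2]|`!)%N.
Proof.
case: forallP => [adm|nadm]; last first.
  rewrite mul0n; apply: eq_card0 => r; rewrite inE; apply: contra_notF nadm.
  move=> /forallP rc i; apply/andP; split.
    apply: contraT; rewrite negb_or negbK => /andP[/eqP ci /negPf sii].
    by have := rc i; rewrite ci /= => /andP[/eqP->]; rewrite eq_sym sii.
  apply/negP => /andP[/eqP ci /eqP csi].
  have := rc i; rewrite ci /= => /eqP ri.
  have := rc (s i); rewrite csi /= andbT -{2}ri (inj_eq perm_inj) => /eqP sii.
  by move: csi; rewrite sii ci.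
rewrite mul1n.
set D := [set i | _ && _].
pose f i := if (c i).1 then s i else i.
(* If [s i = j], admissibility at [i] leaves only [(false, false)] for [j]; then [j] is fixed by
   [s], so [i = j]. *)
have fE i j : i \notin D -> j \notin D -> (c i).1 -> ~~ (c j).1 -> s i <> j.
  rewrite !inE => iD jD ci cj sij; have := adm i; have := adm j.
  rewrite /admissible sij.
  have cij : c i = (true, false) by case: (c i) ci iD => -[] [].
  case ej : (c j) cj => [[] []] //= _; rewrite cij //= andbT => /eqP sj.
  move=> _; have ij : i = j by apply: (@perm_inj _ s); rewrite sj.
  by move: ej; rewrite -ij cij.
have [p0 p0f] : exists p : {perm I}, {in enum (~: D), p =1 f}.
  apply: perm_extend => i j; rewrite !mem_enum !in_setC /f => iD jD.
  case ci: (c i).1; case cj: (c j).1 => //.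
  - exact: perm_inj.
  - by move/fE => h; case: h; rewrite ?ci ?cj.
  - by move/esym/fE => h; case: h; rewrite ?ci ?cj.
rewrite -(card_perm_agree p0); apply: eq_card => r; rewrite !inE.
apply: eq_forallb => i; have := p0f i; have := adm i.
rewrite mem_enum in_setC /admissible inE /f.
case: (c i) => [[] []] //= h e; rewrite ?(e isT) ?andbT //.
move: h => /andP[/eqP -> _]; exact: andbb.
Qed.

(** * From colours to two-state transfer matrices *)

(** The colour [(u, v)] of [i] tells whether the deltas [r i = i] and [r i = s i]
    are dropped; ['X] counts the points where both are. *)
Definition color_weight (R : comNzRingType) (al be e : R) (c : bool * bool) :
    {poly R} :=
  match c with
  | (false, false) => e%:P
  | (true, false) => al%:P
  | (false, true) => be%:P
  | (true, true) => (al * be)%:P * 'X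
  end.

Definition color_transfer (R : comNzRingType) (I : finType) (s : {perm I})
    (al be : I -> R) (i : I) (c d : bool * bool) : {poly R} :=
  color_weight (al i) (be i) (s i == i)%:R c *
  (~~ ((c == (true, false)) && (d == (false, true))))%:R.

Lemma sum_bool2 (V : nmodType) (F : bool * bool -> V) :
  \sum_c F c = (F (true, true) + F (true, false)) +
               (F (false, true) + F (false, false)).
Proof.
transitivity (\sum_p F (p.1, p.2)); first by apply: eq_bigr => -[].
by rewrite -(pair_bigA _ (fun u v => F (u, v))) /= !big_bool.
Qed.

Lemma two_row_sum_transfer (R : comNzRingType) (I : finType) (s : {perm I})
    (al be : I -> R) :
  two_row_sum s al be =
  fact_form #|I| (loop_sum s (color_transfer s al be)).
Proof.
rewrite /loop_sum fact_form_sum /two_row_sum.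
pose wt i (c : bool * bool) :=
  (if c.1 then al i else 1) * (if c.2 then be i else 1).
transitivity (\sum_(c : {ffun I -> bool * bool}) \sum_(r : {perm I})
    \prod_i (wt i (c i) *
      (((c i).1 || (r i == i)) && ((c i).2 || (r i == s i)))%:R)).
  rewrite exchange_big /=; apply: eq_bigr => r _.
  rewrite -(bigA_distr_bigA (fun i (d : bool * bool) =>
    wt i d * ((d.1 || (r i == i)) && (d.2 || (r i == s i)))%:R)).
  apply: eq_bigr => i _.
  rewrite sum_bool2 /wt /=.
  by case: (r i == i); case: (r i == s i) => /=; ring.
apply: eq_bigr => c _.
have natB (J : finType) (P : pred J) :
    \prod_j (P j)%:R = [forall j, P j]%:R :> R.
  case: forallP => [h|/forallP]; first by rewrite big1 // => j _; rewrite h.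
  rewrite negb_forall => /existsP[j /negPf h].
  by rewrite (bigD1 j) //= h mul0r.
transitivity ((\prod_i wt i (c i)) * (#|[set r | fits s c r]|)%:R).
  rewrite -sum1_card natr_sum mulr_sumr [RHS]big_mkcond; apply: eq_bigr => r _.
  rewrite big_split /= natB inE /fits.
  by case: ifP => _; rewrite ?mulr1 ?mulr0.
rewrite card_fits natrM mulrA -natB.
set k := #|[set i | _ && _]|.
transitivity (fact_form #|I| (((\prod_i wt i (c i)) *
   (\prod_i (admissible s i (c i) (c (s i)))%:R))%:P * 'X^k)).
  by rewrite fact_form_monomial // max_card.
congr fact_form.
have -> : 'X^k = \prod_i (if (c i).1 && (c i).2 then 'X else 1 : {poly R}).
  rewrite -big_mkcond /= prodr_const; congr (_ ^+ _).
  by apply: eq_card => i; rewrite !inE.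
rewrite -big_split rmorph_prod /= -big_split; apply: eq_bigr => i _ /=.
rewrite /color_transfer /admissible /wt.
case: (c i) => [[] []] /=; case: (c (s i)) => [[] []] /=;
  case: (s i == i) => /=;
  by rewrite ?(polyC0, polyC1, mulr1, mul1r, mulr0, mul0r).
Qed.

(** A state records whether the previous colour was [(true, false)], the only
    thing the admissibility of the next colour depends on. *)
Definition class_transfer (R : comNzRingType) (I : finType) (s : {perm I})
    (al be : I -> R) (i : I) (t t' : bool) : {poly R} :=
  if t' then (al i)%:P
  else (~~ t)%:R * (be i)%:P + (al i * be i)%:P * 'X + (s i == i)%:R%:P.

(** The 4x4 matrix factors as [U] (weigh the colour, remember its class) times [V] (test the next
    colour). Cyclicity exchanges the factors, leaving 2x2 matrices with [U] taken at [s i]. *)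
Lemma loop_sum_class (R : comNzRingType) (I : finType) (s : {perm I})
    (al be : I -> R) :
  loop_sum s (color_transfer s al be) =
  loop_sum s (fun i => class_transfer s al be (s i)).
Proof.
pose U i (c : bool * bool) t :=
  color_weight (al i) (be i) (s i == i)%:R c * (t == (c == (true, false)))%:R.
pose V (i : I) t (d : bool * bool) : {poly R} :=
  (~~ (t && (d == (false, true))))%:R.
transitivity (loop_sum s (fun i c d => \sum_t U i c t * V i t d)).
  apply: loop_sum_ext => i c d; rewrite big_bool /U /V /color_transfer /=.
  by case: (c == _) => /=; rewrite ?(mulr0, mul0r, mulr1, addr0, add0r).
rewrite loop_sum_cyclic; apply: loop_sum_ext => i t t'.
rewrite sum_bool2 /U /V /class_transfer /=.
by case: t; case: t' => /=; ring.
Qed.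

(** * The gauge matrix and the exchange of primed and unprimed data *)

(** [c] stands for the inverse of b'; [T] is the indeterminate, shifted at the
    fixed points of [s] so as to absorb the colour [(false, false)]. *)
Definition gauge (R : comNzRingType) (T u v b c : R) (x y : bool) : R :=
  if x then (if y then T else T * (v * b))
  else (if y then - (u * c) else T * (1 + v * b)).

Definition gauge_adj (R : comNzRingType) (T u v b c : R) (x y : bool) : R :=
  if x then (if y then T * (1 + v * b) else - (T * (v * b)))
  else (if y then u * c else T).

(** The scalar is the determinant of [gauge]. *)
Lemma mul_gauge_adj (R : comNzRingType) (T u v b c : R) (x y : bool) :
  \sum_z gauge T u v b c x z * gauge_adj T u v b c z y =
  T * (T * (1 + v * b) + u * v * (b * c)) * (x == y)%:R.
Proof.
by rewrite big_bool /gauge /gauge_adj; case: x; case: y => /=; ring.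
Qed.

Lemma mul_adj_gauge (R : comNzRingType) (T u v b c : R) (x y : bool) :
  \sum_z gauge_adj T u v b c x z * gauge T u v b c z y =
  T * (T * (1 + v * b) + u * v * (b * c)) * (x == y)%:R.
Proof.
by rewrite big_bool /gauge /gauge_adj; case: x; case: y => /=; ring.
Qed.

(** Here [a], [b] belong to a point j and [b1] to [s j]. For nonzero data the first hypotheses say
    1/a' - 1/a = u and 1/b' - 1/b = v, with the same [v] at j and [s j]. *)
Lemma class_transfer_gauge (R : comNzRingType) (T u v a a' b b' b1 b1' c c1 : R)
    (L L' : bool -> bool -> R) :
  a - a' = u * a * a' -> b - b' = v * b * b' -> b1 - b1' = v * b1 * b1' ->
  c * b' = 1 -> c1 * b1' = 1 ->
  (forall x y, L x y = if y then a * b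
     else (~~ x)%:R * (a' * b1') + a * b * (a' * b1') * T) ->
  (forall x y, L' x y = if y then a' * b'
     else (~~ x)%:R * (a * b1) + a' * b' * (a * b1) * T) ->
  forall x y, \sum_z L x z * gauge T u v b1 c1 z y =
              \sum_z gauge T u v b c x z * L' z y.
Proof.
move=> ha hb hb1 hc hc1 LE LE' x y.
apply/eqP; rewrite -subr_eq0; apply/eqP.
have ka : a * (1 - u * a') - a' = 0.
  by rewrite (_ : _ - _ = (a - a') - u * a * a'); [rewrite ha subrr | ring].
have kb : b' * (1 + v * b) - b = 0.
  by rewrite (_ : _ - _ = v * b * b' - (b - b')); [rewrite hb subrr | ring].
have kb1 : b1' * (1 + v * b1) - b1 = 0.
  by rewrite (_ : _ - _ = v * b1 * b1' - (b1 - b1')); [rewrite hb1 subrr | ring].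
have kc : c * b' - 1 = 0 by rewrite hc subrr.
have kc1 : c1 * b1' - 1 = 0 by rewrite hc1 subrr.
(* Each entry of the difference is a combination of the five relations above. *)
rewrite !big_bool !LE !LE' /gauge; case: x; case: y => /=.
- transitivity (T * b * (a * (1 - u * a') - a')
    - a * b * a' * u * T * (c1 * b1' - 1)
    - T * a' * (b' * (1 + v * b) - b)); first ring.
  by rewrite ka kb kc1; ring.
- transitivity (T * T * (a * a' * b * (b1' * (1 + v * b1) - b1)
    - a * a' * b1 * (b' * (1 + v * b) - b))); first ring.
  by rewrite kb kb1; ring.
- transitivity (T * b * (a * (1 - u * a') - a')
    - (a' * u + a * b * a' * u * T) * (c1 * b1' - 1)
    - T * a' * (b' * (1 + v * b) - b) + u * a' * (c * b' - 1)); first ring.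
  by rewrite ka kb kc1 kc; ring.
- transitivity (- T * b1 * (a * (1 - u * a') - a')
    + (T * a' + T * T * a * a' * b) * (b1' * (1 + v * b1) - b1)
    - T * T * a * a' * b1 * (b' * (1 + v * b) - b)
    + u * a * a' * b1 * T * (c * b' - 1)); first ring.
  by rewrite ka kb kc kb1; ring.
Qed.

Lemma two_row_sum_swap (F : fieldType) (I : finType) (s : {perm I})
    (a a' b b' : I -> F) (u v : F) :
  (forall i, a i != 0) -> (forall i, a' i != 0) ->
  (forall i, b i != 0) -> (forall i, b' i != 0) ->
  (forall i, a i - a' i = u * a i * a' i) ->
  (forall i, b i - b' i = v * b i * b' i) ->
  two_row_sum s (fun i => a i * b i) (fun i => a' i * b' (s i)) =
  two_row_sum s (fun i => a' i * b' i) (fun i => a i * b (s i)).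
Proof.
move=> a0 a'0 b0 b'0 ha hb.
rewrite !two_row_sum_transfer !loop_sum_class; congr fact_form.
(* Chosen so that multiplying [e i] by the coefficient of ['X] gives the fixed-point term of
   [class_transfer]. *)
pose e i := (s i == i)%:R / (a i * b i * (a' i * b' i)).
pose T i : {poly F} := 'X + (e i)%:P.
(* [e] vanishes off the fixed points, so [T] is constant along cycles and the gauges at [i] and
   [s i] share it. *)
have es i : e (s i) = e i.
  rewrite /e (inj_eq perm_inj); case: eqP => [->//|_]; by rewrite !mul0r.
pose par (g : {poly F} -> {poly F} -> {poly F} -> {poly F} -> {poly F} ->
    bool -> bool -> {poly F}) i :=
  g (T (s i)) u%:P v%:P (b (s i))%:P ((b' (s i))^-1)%:P.
have hbc i : b i / b' i = 1 + v * b i.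
  by rewrite -[b i in LHS](subrK (b' i)) hb mulrDl mulfK // divff // addrC.
pose d i := T (s i) * (T (s i) * (1 + v%:P * (b (s i))%:P) +
    u%:P * v%:P * ((b (s i))%:P * ((b' (s i))^-1)%:P)).
apply: (@loop_sum_gauge _ _ _ _ (par (@gauge _)) (par (@gauge_adj _)) d).
- move=> i; rewrite /d; set j := s i.
  (* The determinant becomes (X + e)(X + e + uv) b/b', a product of nonzero factors. *)
  have -> : 1 + v%:P * (b j)%:P = (b j / b' j)%:P.
    by rewrite hbc polyCD polyC1 polyCM.
  rewrite -(polyCM (b j)) -mulrDl -(polyCM u) /T -addrA -polyCD !mulf_neq0 //.
  + by rewrite -size_poly_eq0 size_XaddC.
  + by rewrite -size_poly_eq0 size_XaddC.
  + by rewrite polyC_eq0 mulf_neq0 // invr_neq0.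
- by move=> i x y; apply: mul_gauge_adj.
- by move=> i x y; apply: mul_adj_gauge.
move=> i; rewrite /par; set j := s i.
have -> : T (s j) = T j by rewrite /T es.
apply: (@class_transfer_gauge _ (T j) u%:P v%:P (a j)%:P (a' j)%:P (b j)%:P
  (b' j)%:P (b (s j))%:P (b' (s j))%:P).
- by rewrite -rmorphB ha !rmorphM.
- by rewrite -rmorphB hb !rmorphM.
- by rewrite -rmorphB hb !rmorphM.
- by rewrite -rmorphM mulVf.
- by rewrite -rmorphM mulVf.
- move=> x [] /=; rewrite /class_transfer ?rmorphM // -addrA; congr (_ + _).
  rewrite /T mulrDr -!rmorphM; congr (_ + _%:P).
  rewrite /e; case: eqP => [->|_]; last by rewrite mul0r mulr0.
  by rewrite div1r divff // !mulf_neq0.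
- move=> x [] /=; rewrite /class_transfer ?rmorphM // -addrA; congr (_ + _).
  rewrite /T mulrDr -!rmorphM; congr (_ + _%:P).
  rewrite /e; case: eqP => [->|_]; last by rewrite mul0r mulr0.
  by rewrite div1r [_ * (a j * _)]mulrC divff // !mulf_neq0.
Qed.

(** * Entries of the matrix product *)

Definition perm_weight (F : fieldType) (I : finType) (a b : I -> F)
    (p r : {perm I}) : F :=
  \prod_i ((p i == r i)%:R + a i * b (p i)).

(** Once the product of all [b j] is pulled out, the remaining factor depends on [p i] only where
    [p i = r i]. *)
Lemma perm_weight_sym (F : fieldType) (I : finType) (a b : I -> F)
    (p r : {perm I}) :
  (forall i, b i != 0) -> perm_weight a b p r = perm_weight a b r p.
Proof.
move=> b0.
have E (q r' : {perm I}) : perm_weight a b q r' =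
    \prod_j b j * \prod_i (if q i == r' i then (1 + a i * b (q i)) / b (q i)
                           else a i).
  rewrite (reindex_inj (@perm_inj _ q)) /= -big_split; apply: eq_bigr => i _ /=.
  case: ifP => _ /=; last by rewrite add0r mulrC.
  by rewrite [RHS]mulrC divfK.
rewrite !E; congr (_ * _); apply: eq_bigr => i _.
by rewrite eq_sym; case: eqP => // ->.
Qed.

(** By symmetry [r] is compared with [p] and with [q]; replacing [r] by [r * p] compares it with the
    identity and with [q * p^-1]. *)
Lemma sum_perm_weight (F : fieldType) (I : finType) (a a' b b' : I -> F)
    (p q : {perm I}) :
  (forall i, b' i != 0) ->
  \sum_r perm_weight a b p r * perm_weight a' b' r q =
  two_row_sum (q * p^-1)%g (fun i => a i * b (p i))
    (fun i => a' i * b' (p ((q * p^-1)%g i))).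
Proof.
move=> b'0.
under eq_bigr => r _ do rewrite (perm_weight_sym _ r q) //.
rewrite (reindex_inj (@mulIg _ p)); apply: eq_bigr => r _.
rewrite /perm_weight -big_split; apply: eq_bigr => i _ /=.
rewrite !permM permKV (inj_eq perm_inj) (eq_sym i) (eq_sym (q i)).
by rewrite (canF_eq (permK p)).
Qed.

Theorem theorem5p3 (R : realType) (n : nat) (n_gt0 : (0 < n)%N)
    (x y : 'I_n -> R[i]) (xi xi' eta eta' : R[i])
    (xi_x : forall i : 'I_n, xi != x i)
    (xi'_x : forall i : 'I_n, xi' != x i)
    (eta_y : forall i : 'I_n, eta != y i)
    (eta'_y : forall i : 'I_n, eta' != y i) :
  M_mx x y xi eta *m M_mx x y xi' eta' = M_mx x y xi' eta' *m M_mx x y xi eta.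
Proof.
have ne (f : 'I_n -> R[i]) z i : z != f i -> f i - z != 0.
  by rewrite subr_eq0 eq_sym.
pose a z i := (x i - z)^-1; pose b z i := (y i - z)^-1.
have ME z w p r : M_entry x y z w p r = perm_weight (a z) (b w) p r.
  by apply: eq_bigr => i _; rewrite div1r invfM.
apply/matrixP => k l; rewrite !mxE.
have S z w z' w' : \sum_j M_mx x y z w k j * M_mx x y z' w' j l =
    \sum_r perm_weight (a z) (b w) (enum_val k) r *
           perm_weight (a z') (b w') r (enum_val l).
  rewrite [RHS](reindex _ (onW_bij _ (@enum_val_bij _))) /=.
  by apply: eq_bigr => j _; rewrite !mxE !ME.
(* The resolvent identity: its constant [z - z'] does not depend on the point [t], which supplies
   [u] and [v]. *)
have diff z z' t : t - z != 0 -> t - z' != 0 ->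
    (t - z)^-1 - (t - z')^-1 = (z - z') * (t - z)^-1 * (t - z')^-1 :> R[i].
  by move=> h h'; field; rewrite h h'.
rewrite !S !sum_perm_weight; try by move=> i; rewrite invr_neq0 ?ne.
set s := (_ * _)%g; set p := enum_val k.
apply: (@two_row_sum_swap _ _ s (a xi) (a xi') (b eta \o p) (b eta' \o p)
  (xi - xi') (eta - eta')) => i /=; rewrite ?invr_neq0 ?ne //.
- by apply: diff; rewrite ne.
- by apply: diff; rewrite ne.
Qed.
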